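(* There exists a one-dimensional persistent cellular automaton $\mathcal{U}$ such that $\mathcal{A}\preccurlyeq\mathcal{U}$ for every one-dimensional persistent cellular automaton $\mathcal{A}$.
   Context: A one-dimensional cellular automaton (CA) over a finite alphabet $Q$ is a map $F:Q^{\mathbb{Z}}\to Q^{\mathbb{Z}}$, $F(c)(z)=f(c(z+v_1),\dots,c(z+v_k))$ for a finite neighborhood $\{v_1,\dots,v_k\}\subseteq\mathbb{Z}$ and local rule $f$; $\sigma_z(c)(z')=c(z'+z)$, and $Q^{\mathbb{Z}}$ has the product topology. A CA $F$ is persistent if there is a state $q_0\in Q$ such that for every configuration $c$ and every $i\in\mathbb{Z}$, $c(i)=q_0$ implies $F(c)(i)=q_0$. The canonical action of a CA $F$ is the $\mathbb{N}\times\mathbb{Z}$-action $((t,z),x)\mapsto\sigma_z\circ F^t(x)$; a scaled action is its restriction to a submonoid $t_0\mathbb{N}\times z_1\mathbb{Z}$ with $t_0,z_1>0$, two such submonoids being identified by the canonical isomorphism $(t_0a,z_1b)\mapsto(t_0'a,z_1'b)$. An action $\phi'$ on $X'$ is a factor of an action $\phi$ on $X$ if there is a continuous onto $\pi:X\to X'$ with $\pi(\phi(m,x))=\phi'(i(m),\pi(x))$ for all $m,x$. For CA $S,T$, $T\preccurlyeq S$ means some scaled action of $S$ factors onto some scaled action of $T$. *)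

(* Defs.v *)
From mathcomp Require Import all_boot all_order all_algebra.
From mathcomp Require Import all_classical all_reals all_analysis.

Set Implicit Arguments.
Unset Strict Implicit.
Unset Printing Implicit Defensive.

Import Order.TTheory GRing.Theory Num.Theory.
Local Open Scope classical_set_scope.
Local Open Scope ring_scope.

(* The neighborhood is listed as a tuple; repeated entries are harmless, since
   the local rule may ignore them. *)
Record ca := CA {
  ca_state : finType;
  ca_arity : nat;
  ca_nbhd : ca_arity.-tuple int;
  ca_rule : ca_arity.-tuple ca_state -> ca_state
}.

Definition config (Q : finType) : Type :=
  prod_topology (fun _ : int => discrete_topology Q).

Definition global_map (A : ca) (c : config (ca_state A)) : config (ca_state A) :=
  fun z => ca_rule (map_tuple (fun v => c (z + v) : ca_state A) (ca_nbhd A)).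

Definition shift (Q : finType) (z : int) (c : config Q) : config Q :=
  fun z' => c (z' + z).

Definition persistent (A : ca) : Prop :=
  exists q0 : ca_state A, forall (c : config (ca_state A)) (i : int),
    c i = q0 -> global_map c i = q0.

Definition canonical_action (A : ca) (m : nat * int) (x : config (ca_state A)) :
    config (ca_state A) :=
  shift m.2 (iter m.1 (@global_map A) x).

Definition scaled_monoid (t0 : nat) (z1 : int) : set (nat * int) :=
  [set m | exists (a : nat) (b : int), m = ((t0 * a)%N, z1 * b)].

(* Meant on [scaled_monoid t0 z1] with t0, z1 > 0, where both divisions are
   exact; see [scale_isoE]. *)
Definition scale_iso (t0 : nat) (z1 : int) (t0' : nat) (z1' : int)
    (m : nat * int) : nat * int :=
  ((t0' * (m.1 %/ t0))%N, z1' * (m.2 %/ z1)%Z).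

Lemma scale_isoE (t0 : nat) (z1 : int) (t0' : nat) (z1' : int) (a : nat) (b : int) :
  (0 < t0)%N -> 0 < z1 ->
  scale_iso t0 z1 t0' z1' ((t0 * a)%N, z1 * b) = ((t0' * a)%N, z1' * b).
Proof.
move=> t0_gt0 z1_gt0.
by rewrite /scale_iso /= mulKn // mulKz // gt_eqF.
Qed.

(* phi is considered only on the submonoid D of M; i identifies D with the
   submonoid of M' by which phi' acts. *)
Definition is_factor (M M' : Type) (X X' : topologicalType) (D : set M)
    (i : M -> M') (phi : M -> X -> X) (phi' : M' -> X' -> X') : Prop :=
  exists pi : X -> X',
    [/\ continuous pi,
        forall y : X', exists x : X, pi x = y
      & forall (m : M) (x : X), D m -> pi (phi m x) = phi' (i m) (pi x)].

Definition simulates (S T : ca) : Prop :=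
  exists (t0 : nat) (z1 : int) (t0' : nat) (z1' : int),
    [/\ (0 < t0)%N, 0 < z1, (0 < t0')%N, 0 < z1'
      & is_factor (scaled_monoid t0 z1) (scale_iso t0 z1 t0' z1')
          (@canonical_action S) (@canonical_action T)].

Notation "T ≼ S" := (simulates S T) (at level 70, no associativity).

(* Main.v *)
Require Import Defs.
From mathcomp Require Import all_boot all_order all_algebra.
From mathcomp Require Import all_classical all_reals all_analysis.
From mathcomp Require Import zify.

(** A configuration of the universal automaton is read in blocks of width [w].
    Walls cut the line, and inside a walled block eight tracks form one closed
    conveyor belt of length [8w] whose codes may be erased but are not otherwise
    altered, so a block carrying the right codes at the right phase (a good block)
    is good again after [8w] steps, and any other block stays bad.  This is what
    makes it consistent to decode every bad block as the persistent state.

    A good block must treat a bad neighbour as persistent, so it has to recognize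
    one.  During the first [2w] steps it compares, across the wall, the codes
    passing by with those its own belt predicts.  A neighbour can pass this test
    without being good only if its far wall is missing and the expected codes stream
    in from beyond; but then the marked code meets its own copy at the place of
    the missing wall, which a good block never sees, and is erased.

    The remaining time is spent on computing.  Codes are equipped with a mutable
    payload bit; the payloads of the neighbours are copied at the walls, and the
    meetings of right-moving and left-moving codes evaluate a programmable logic
    array: cell [j] tests the [j]-th row of the truth table of the simulated
    rule, and then the matching row writes its output onto the belt. *)

Set Implicit Arguments.
Unset Strict Implicit.
Unset Printing Implicit Defensive.

Import Order.TTheory GRing.Theory Num.Theory.
Local Open Scope classical_set_scope.
Local Open Scope ring_scope.

(** * The local rule *)

Lemma ord8_ind (P : 'I_8 -> Prop) :
  P 0 -> P 1 -> P 2 -> P 3 -> P 4 -> P 5 -> P 6 -> P 7 -> forall x, P x.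
Proof.
move=> p0 p1 p2 p3 p4 p5 p6 p7 x; rewrite -(natr_Zp (x : 'Z_8)).
by case: x => [[|[|[|[|[|[|[|[|m]]]]]]]] h].
Qed.

Definition letter := (bool * bool * bool * bool * (bool * bool * bool) * bool)%type.
Definition is_first (l : letter) : bool := l.1.1.1.1.1.
Definition is_init (l : letter) : bool := l.1.1.1.1.2.
Definition is_bit (l : letter) : bool := l.1.1.1.2.
Definition selects (l : letter) : bool := l.1.1.2.
Definition inputs (l : letter) : bool * bool * bool := l.1.2.
Definition output (l : letter) : bool := l.2.

Definition code := (letter * 'I_8)%type.
Definition item := (option code * bool)%type.

(** A wall bit (is there a wall between this cell and its right neighbour?), eight
    tracks, a mark, and one link bit per side.  Items on even tracks move right,
    items on odd tracks move left, and an item of track [x - 1] that meets a wall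
    continues on track [x]; [None] is an erased code. *)
Definition cell := (bool * {ffun 'I_8 -> item} * (bool * (bool * bool)))%type.
Definition wall (s : cell) : bool := s.1.1.
Definition track (s : cell) (x : 'I_8) : item := s.1.2 x.
Definition mark (s : cell) : bool := s.2.1.
Definition link_left (s : cell) : bool := s.2.2.1.
Definition link_right (s : cell) : bool := s.2.2.2.
Definition codeof (s : cell) (x : 'I_8) : option code := (track s x).1.
Definition payload (s : cell) (x : 'I_8) : bool := (track s x).2.

Definition has_tag (o : option code) (g : 'I_8) : bool :=
  if o is Some c then c.2 == g else false.
Definition test_code (p : pred letter) (o : option code) : bool :=
  if o is Some c then p c.1 else false.

Definition dead : cell := (true, [ffun=> (None, false)], (false, (false, false))).

Definition turns (l s : cell) (x : 'I_8) : bool := if odd x then wall s else wall l.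

Definition source (l s r : cell) (x : 'I_8) : item :=
  if turns l s x then track s (x - 1) else if odd x then track r x else track l x.

(** An arriving first code that equals the code leaving in the opposite direction
    on track [x - 1] is the latter's copy: a wall is missing, and it is erased. *)
Definition new_code (l s r : cell) (x : 'I_8) : option code :=
  let c := (source l s r x).1 in
  if [&& ~~ turns l s x, test_code is_first c & c == codeof s (x - 1)]
  then None else c.

(** Tag 6 carries the state of a block.  On the turn [0 -> 1] tag 5 fetches the
    bit of the right neighbour, on the turn [1 -> 2] tag 7 fetches that of the left
    neighbour (the neighbour's item of tag 6 is then just across the wall), and an
    unlinked side yields 0.  Track 4 collects the output, starting from 0. *)
Definition new_payload (l s r : cell) (x : 'I_8) : bool :=
  if turns l s x then
    if (x == 1) && has_tag (codeof s 0) 5 then link_right s && payload r 1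
    else if (x == 2) && has_tag (codeof s 1) 7 then link_left s && payload l 0
    else (x != 4) && payload s (x - 1)
  else (source l s r x).2 ||
    [&& x == 4, mark l & test_code output (codeof l 5)].

Definition expected (g : 'I_8) (l : letter) : bool :=
  if g == 7 then (inputs l).1.1 else if g == 6 then (inputs l).1.2 else (inputs l).2.

(** The mark of a cell records whether its row of the truth table has passed all
    tests so far; only the items of tags 7, 6, 5, in this order, are tests. *)
Definition new_mark (s : cell) : bool :=
  match codeof s 2, codeof s 3 with
  | Some (l, g), Some (l', _) =>
    if is_init l && (g == 7) then selects l'
    else if is_bit l && (5 <= g)%N then mark s && (payload s 2 == expected g l')
    else mark s
  | _, _ => mark s
  end.

Definition retag (d : 'I_8) (o : option code) : option code :=
  omap (fun c => (c.1, c.2 + d)) o.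

(** [s] and [o] lie on both sides of a wall; in adjacent good blocks the items that
    face each other have the same letter and tags differing by one. *)
Definition matches (s o : cell) : bool :=
  [forall x : 'I_8, codeof o x ==
    if odd x then retag 1 (codeof s (x - 1)) else retag (-1) (codeof s (x + 1))].

(** The first test recognizes time 0 of the macrostep, the second one times before
    [2w]; [x] is 0 at the right end of a block and 1 at its left end. *)
Definition new_link (x : 'I_8) (s o : cell) (b : bool) : bool :=
  if has_tag (codeof s (x + 1)) (x + 1) && test_code is_first (codeof s (x + 1))
  then matches s o
  else if has_tag (codeof s x) x || has_tag (codeof s x) (x - 1)
  then b && matches s o else b.

(** The exception for [dead] gives persistence. It never fires inside a good block, where all eight
    codes of every cell are present. *)
Definition step (l s r : cell) : cell :=
  if s == dead then dead else
  (wall s, [ffun x => (new_code l s r x, new_payload l s r x)],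
   (new_mark s, (new_link 1 s l (link_left s), new_link 0 s r (link_right s)))).

Lemma step_wall l s r : wall (step l s r) = wall s.
Proof. by rewrite /step; case: eqP => // ->. Qed.

Lemma step_codeof l s r x :
  codeof (step l s r) x = if s == dead then None else new_code l s r x.
Proof. by rewrite /step; case: ifP => // _; rewrite /codeof /track ffunE. Qed.

Lemma step_codeof_source l s r x c : codeof (step l s r) x = Some c ->
  (source l s r x).1 = Some c /\
  (turns l s x \/ ~~ (is_first c.1 && (codeof s (x - 1) == Some c))).
Proof.
rewrite step_codeof; case: ifP => // _; rewrite /new_code.
case: ifP => // H E; split=> //; move: H; rewrite E /=.
by case: (turns l s x) => /= H; [left | right; rewrite eq_sym H].
Qed.

(** The presence of any code [d] in [s] excludes [dead], so only the erasing test remains to be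
    passed. *)
Lemma step_codeof_live l s r x y c d : (source l s r x).1 = Some c ->
  codeof s y = Some d ->
  turns l s x \/ ~~ (is_first c.1 && (codeof s (x - 1) == Some c)) ->
  codeof (step l s r) x = Some c.
Proof.
move=> E Ey H; rewrite step_codeof; case: eqP => [ed|_].
  by move: Ey; rewrite ed /codeof /track ffunE.
rewrite /new_code E /= eq_sym; case: H => [->//|/negbTE H].
by rewrite H andbF.
Qed.

Lemma odd_succ8 (x : 'I_8) : odd (x + 1)%R = ~~ odd x.
Proof. by move: x; apply: ord8_ind. Qed.

Lemma odd_pred8 (x : 'I_8) : odd (x - 1)%R = ~~ odd x.
Proof. by move: x; apply: ord8_ind. Qed.

(** * The periodic word on a belt, and how a wall recognizes it on the other side *)

Section Pattern.
Variables (w : nat) (Q : nat -> letter).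
Hypothesis w_gt1 : (1 < w)%N.
Hypothesis firstQ : forall u, (u < w)%N -> is_first (Q u) = (u == 0%N).

(** The belt of a good block is the word [Q] of length [w] written eight times, with
    increasing tags; [pat x a] is its code at offset [a], possibly outside [0, w),
    from the beginning of track [x]. *)
Definition pat (x : 'I_8) (a : int) : code :=
  (Q `|(a %% w)%Z|, x + (a %/ w)%Z%:~R).

Lemma pat_shift (x : 'I_8) (a : int) (z : int) : pat (x + z%:~R) a = pat x (a + z * w%:Z).
Proof.
rewrite /pat (addrC a) modzMDl divzMDl; last by lia.
by rewrite (intrD _ z) addrA.
Qed.

Lemma pat_succ (x : 'I_8) (a : int) : pat (x + 1) a = pat x (a + w%:Z).
Proof. by have := pat_shift x a 1; rewrite mul1r. Qed.

Lemma pat_pred (x : 'I_8) (a : int) : pat (x - 1) a = pat x (a - w%:Z).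
Proof. by have := pat_shift x a (-1); rewrite mulN1r. Qed.

Lemma pat_period (x : 'I_8) (a : int) : pat x (a + 8 * w%:Z) = pat x a.
Proof.
by rewrite -pat_shift; congr (pat _ _); rewrite (_ : 8%:~R = 0) ?addr0 //; apply/val_inj.
Qed.

Lemma patE (x : 'I_8) (a q : int) (u : nat) :
  a = q * w%:Z + u%:Z -> (u < w)%N -> pat x a = (Q u, x + q%:~R).
Proof.
move=> -> h; rewrite /pat modzMDl divzMDl; last by lia.
by rewrite divz_small ?addr0 ?modz_small //; lia.
Qed.

Lemma pat_first (x : 'I_8) a : is_first (pat x a).1 = ((a %% w)%Z == 0).
Proof.
rewrite /pat firstQ; first by lia.
by have := ltz_pmod a (_ : 0 < w%:Z); have := modz_ge0 a (_ : w%:Z != 0); lia.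
Qed.

(** The quotient of [u] by [w] is -1 or -2, so already the tags differ. *)
Lemma pat0_neq (x : 'I_8) (u : int) : - 2 * w%:Z <= u -> u < 0 -> pat x 0 <> pat x u.
Proof.
move=> h1 h2; have [h3|h3] := leP (- w%:Z) u.
  rewrite (@patE x u (-1) (absz (u + w%:Z))) ?(@patE x 0 0 0); try lia.
  by case=> _; elim/ord8_ind: x.
rewrite (@patE x u (-2) (absz (u + 2 * w%:Z))) ?(@patE x 0 0 0); try lia.
by case=> _; elim/ord8_ind: x.
Qed.

Definition off (x : 'I_8) (j t : int) : int := if odd x then w%:Z - 1 - j - t else j - t.

Section Detection.
(** Seen from a wall, [tr x d t] is the code at distance [d] in the neighbouring
    block, where even tracks lead away from the wall; on the left side the actual
    track is [x + 1], hence the shift [s].  [fw d] is the wall beyond distance [d]. *)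
Variables (tr : 'I_8 -> nat -> nat -> option code) (fw : nat -> bool) (s : 'I_8).
Hypothesis back_in : forall (x : 'I_8) d t k, odd x -> tr x d t.+1 = Some k ->
  if fw d then tr (x - 1) d t = Some k
  else tr x d.+1 t = Some k /\ ~~ (is_first k.1 && (tr (x - 1) d t == Some k)).
Hypothesis back_out : forall (x : 'I_8) d t k, ~~ odd x -> fw d = false ->
  tr x d.+1 t.+1 = Some k -> tr x d t = Some k.
Hypothesis forth_out : forall d t k k', fw d = false -> tr 0 d t = Some k ->
  tr 7 d.+1 t = Some k' -> k' != k -> tr 0 d.+1 t.+1 = Some k.
Hypothesis border : forall (x : 'I_8) (t : nat), (t < 2 * w)%N ->
  tr x 0 t = Some (pat (x + s) (off x 0 t)).

Let incoming (x : 'I_8) d : odd x -> (forall d', (d' < d)%N -> fw d' = false) ->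
  forall t, (t + d < 2 * w)%N -> tr x d t = Some (pat (x + s) (off x d t)).
Proof.
move=> ox; elim: d => [|d IH] hd t ht; first by rewrite border //; lia.
have := IH _ t.+1 => H; have := back_in ox (H _ _).
rewrite hd // => /(_ _ _)[]; try lia; first by move=> d' ?; apply: hd; lia.
by move=> -> _; congr (Some (pat _ _)); rewrite /off ox; lia.
Qed.

Let outgoing_back (x : 'I_8) d : ~~ odd x -> (forall d', (d' < d)%N -> fw d' = false) ->
  forall e t k, (e <= d)%N -> tr x d (t + (d - e))%N = Some k -> tr x e t = Some k.
Proof.
move=> ox; elim: d => [|d IH] hd e t k.
  by rewrite leqn0 => /eqP ->; rewrite subn0 addn0.
rewrite leq_eqVlt => /orP[/eqP ->|he]; first by rewrite subnn addn0.
rewrite subSn // addnS => /(back_out ox (hd d (leqnn _))).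
by apply: IH => // d' ?; apply: hd; lia.
Qed.

(** A first wall at distance [d] reflects the belt too early: the code seen there on track 1 at time
    [2w - 1 - d] must have left the near wall on track 0 at time [2(w - 1 - d)], with offset 0. The
    border prescribes the offset [-2(w - 1 - d)] at that time, and this is negative. *)
Lemma no_wall_before d : (d < w.-1)%N -> fw d = false.
Proof.
elim/ltn_ind: d => d IH hd; case fd: (fw d) => //.
have hd' : forall d', (d' < d)%N -> fw d' = false by move=> d' ?; apply: IH => //; lia.
(* This is the last time that [incoming] covers at distance [d]; it makes the offset exactly
   [-w]. *)
have := incoming (x := 1) isT hd' (t := (2 * w - 2 - d).+1).
move=> /(_ _); rewrite (_ : off 1 d _ = - w%:Z); last by rewrite /off /=; lia.
move=> H; have {H} := back_in (x := 1) isT (H _); rewrite fd subrr => H.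
have {H} H := H ltac:(lia).
have := @outgoing_back 0 d isT hd' 0 (2 * w - 2 - d - d)%N _ (leq0n _).
move=> /(_ (pat (1 + s) (- w%:Z))); rewrite subn0 subnK; last by lia.
move=> /(_ H); rewrite border; last by lia.
rewrite (addrC 1) pat_succ addNr add0r => /Some_inj/esym E.
by exfalso; move: E; apply: pat0_neq; rewrite /off /=; lia.
Qed.

(** Otherwise the first code, sent out on track 0 at time 0, reaches distance [w.-1] at time [w.-1],
    just when its copy enters there on track 1. The copy would be erased, yet the border forces it
    to be present at time [w]. *)
Lemma wall_at_width : fw w.-1.
Proof.
case fwl: (fw w.-1) => //.
have hd : forall d', (d' < w)%N -> fw d' = false.
  move=> d' h; have [/no_wall_before //|h'] := ltnP d' w.-1.
  by rewrite (_ : d' = w.-1) //; lia.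
have hd' d : (d <= w)%N -> forall d', (d' < d)%N -> fw d' = false.
  by move=> h d' ?; apply: hd; lia.
(* The outgoing first code is not itself erased: the codes it meets on track 7 lie at negative
   offsets when counted from the start of track 0. *)
have out d : (d <= w.-1)%N -> tr 0 d d = Some (pat s 0).
  elim: d => [_|d IH h]; first by rewrite border ?add0r //; lia.
  apply: forth_out (IH _) (incoming _ _ _) _ => //; try lia.
  - by apply: hd; lia.
  - by apply: hd'; lia.
  apply/eqP; rewrite (_ : 7 = -1 :> 'I_8); last by apply/val_inj.
  rewrite (addrC (-1)) pat_pred => /esym; apply: pat0_neq; rewrite /off /=; lia.
have H : tr 1 w.-1 w.-1.+1 = Some (pat (1 + s) (off 1 w.-1 w.-1.+1)).
  by apply: incoming => //; [apply: hd' | ]; lia.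
have := back_in (x := 1) isT H; rewrite fwl subrr (out w.-1) // (addrC 1) pat_succ.
have -> : off 1 w.-1 w.-1.+1 + w%:Z = 0 by rewrite /off /=; lia.
by rewrite eqxx pat_first mod0z eqxx => -[].
Qed.

(** Incoming tracks are known directly. An outgoing code is found again on the next track, after its
    reflection at the far wall. *)
Lemma window_codes x d : (d < w)%N -> tr x d 0 = Some (pat (x + s) (off x d 0)).
Proof.
move=> h; have hd d' : (d' < d)%N -> fw d' = false by move=> ?; apply: no_wall_before; lia.
case ox: (odd x); first by apply: incoming => //; lia.
have hd' d' : (d' < w.-1)%N -> fw d' = false by exact: no_wall_before.
have ox' : odd (x + 1)%R by rewrite odd_succ8 ox.
have := incoming ox' hd' (t := (w.-1 - d).+1) => H.
have {H} := back_in ox' (H _); rewrite wall_at_width addrK => /(_ _) H.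
have := @outgoing_back x w.-1 _ hd' d 0 _ _ (H _); rewrite ox => -> //; try lia.
congr (Some _); rewrite addrAC pat_succ; congr pat.
by rewrite /off ox ox' /=; lia.
Qed.

End Detection.
End Pattern.

(** * Blocks *)

Lemma retag_pat w Q (x d : 'I_8) (a : int) : retag d (Some (pat w Q x a)) = Some (pat w Q (x + d) a).
Proof. by rewrite /retag /= addrAC. Qed.

Section Evolution.
Variables (w : nat) (Q : nat -> letter).
Hypothesis w_gt1 : (1 < w)%N.
Hypothesis firstQ : forall u, (u < w)%N -> is_first (Q u) = (u == 0%N).
Variable X : nat -> int -> cell.
Hypothesis stepX : forall t z, X t.+1 z = step (X t (z - 1)) (X t z) (X t (z + 1)).

Local Notation wpat := (pat w Q).
Local Notation woff := (off w).

Lemma wallX t z : wall (X t z) = wall (X 0 z).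
Proof. by elim: t z => // t IH z; rewrite stepX step_wall IH. Qed.

Definition walled (c : int -> cell) (b : int) : Prop :=
  [/\ wall (c (b - 1)), wall (c (b + w%:Z - 1)) &
      forall j : nat, (j < w.-1)%N -> wall (c (b + j%:Z)) = false].

Definition coded (c : int -> cell) (b : int) (t : nat) : Prop :=
  forall (x : 'I_8) (j : nat), (j < w)%N -> codeof (c (b + j%:Z)) x = Some (wpat x (woff x j t)).

Definition good (c : int -> cell) (b : int) : Prop := walled c b /\ coded c b 0.

Lemma walledX t b : walled (X t) b <-> walled (X 0) b.
Proof. by split=> -[h1 h2 h3]; split=> [||j /h3]; rewrite ?wallX // -?(wallX t). Qed.

Lemma back_left t z (x : 'I_8) c : odd x -> codeof (X t.+1 z) x = Some c ->
  if wall (X t z) then codeof (X t z) (x - 1) = Some c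
  else codeof (X t (z + 1)) x = Some c /\
       ~~ (is_first c.1 && (codeof (X t z) (x - 1) == Some c)).
Proof.
move=> ox; rewrite stepX => /step_codeof_source[].
by rewrite /source /turns ox; case: ifP => // _ h1 []// h2.
Qed.

Lemma back_right t z (x : 'I_8) c : ~~ odd x -> codeof (X t.+1 z) x = Some c ->
  if wall (X t (z - 1)) then codeof (X t z) (x - 1) = Some c
  else codeof (X t (z - 1)) x = Some c /\
       ~~ (is_first c.1 && (codeof (X t z) (x - 1) == Some c)).
Proof.
move=> /negbTE ox; rewrite stepX => /step_codeof_source[].
by rewrite /source /turns ox; case: ifP => // _ h1 []// h2.
Qed.

(** Codes are moved or erased but never created, so a code present at time [t.+1] can be traced back
    one step. This direction keeps bad blocks bad. *)
Lemma coded_pred t b : walled (X 0) b -> coded (X t.+1) b t.+1 -> coded (X t) b t.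
Proof.
move=> [wl wr wi] H x j hj; case ox: (odd x).
- case: j hj => [|j] hj.
    have ox1 : ~~ odd (x + 1)%R by rewrite odd_succ8 ox.
    have := back_right ox1 (H (x + 1) 0%N hj).
    rewrite addr0 wallX wl addrK => ->; rewrite pat_succ //.
    by congr (Some (wpat _ _)); rewrite /woff ox (negbTE ox1); lia.
  have := back_left ox (H x j (ltnW hj)); rewrite wallX wi; last by lia.
  rewrite (_ : b + j.+1%:Z = b + j%:Z + 1); last by lia.
  by move=> [-> _]; congr (Some (wpat _ _)); rewrite /woff ox; lia.
have [hj'|hj'] := ltnP j w.-1.
  have := back_right (negbT ox) (H x j.+1 ltac:(lia)).
  rewrite (_ : b + j.+1%:Z - 1 = b + j%:Z); last by lia.
  rewrite wallX wi // => -[-> _].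
  by congr (Some (wpat _ _)); rewrite /woff ox; lia.
have ox1 : odd (x + 1)%R by rewrite odd_succ8 ox.
have := back_left ox1 (H (x + 1) j hj).
rewrite wallX addrK (_ : b + j%:Z = b + w%:Z - 1) ?wr; last by lia.
move=> ->; rewrite pat_succ //.
by congr (Some (wpat _ _)); rewrite /woff ox ox1; lia.
Qed.

(** First codes sit at multiples of [w]; less than [w] apart, the two offsets coincide, and then the
    tags differ by one. Hence the erasing test never succeeds inside a good block. *)
Lemma no_meeting (x y : 'I_8) (a a' : int) : x = y + 1 -> - w%:Z < a - a' < w%:Z ->
  is_first (wpat x a).1 -> wpat y a' <> wpat x a.
Proof.
move=> -> h f E; have f' : is_first (wpat y a').1 by rewrite E.
rewrite !pat_first // in f f'.
have Ea : a = (a %/ w)%Z * w by rewrite {1}(divz_eq a w) (eqP f) addr0.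
have Ea' : a' = (a' %/ w)%Z * w by rewrite {1}(divz_eq a' w) (eqP f') addr0.
have aa : a = a'.
  have w0 : 0 < w%:Z by lia.
  move: h; rewrite Ea Ea' -mulrBl => /andP[].
  rewrite -[X in X < _](mulN1r w%:Z) (ltr_pM2r w0) => h1.
  rewrite -[X in _ < X](mul1r w%:Z) (ltr_pM2r w0) => h2.
  by congr (_ * _); lia.
move: E; rewrite aa => /(congr1 snd) /=; rewrite addrAC => /eqP.
by rewrite -subr_eq0 opprD addNKr oppr_eq0.
Qed.

Lemma coded_succ t b : walled (X 0) b -> coded (X t) b t -> coded (X t.+1) b t.+1.
Proof.
move=> [wl wr wi] H x j hj; rewrite stepX; have Hs := H x j hj.
have Hp := H (x - 1) j hj; case ox: (odd x).
- have ox1 : ~~ odd (x - 1)%R by rewrite odd_pred8 ox.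
  have [hj'|hj'] := ltnP j w.-1.
    have Hn := H x j.+1 ltac:(lia).
    rewrite (_ : woff x j t.+1 = woff x j.+1 t); last by rewrite /woff ox; lia.
    apply: step_codeof_live (Hs) _.
      by rewrite /source /turns ox wallX wi // -Hn /codeof; congr (track (X _ _) _).1; lia.
    right; apply/negP => /andP[f /eqP]; rewrite Hp => /Some_inj; apply: no_meeting => //.
      by rewrite subrK.
    by rewrite /woff ox (negbTE ox1); lia.
  apply: step_codeof_live (Hs) _.
    rewrite /source /turns ox wallX (_ : b + j%:Z = b + w%:Z - 1) ?wr; last by lia.
    rewrite -[LHS]/(codeof _ _) (_ : b + w%:Z - 1 = b + j%:Z) ?Hp; last by lia.
    rewrite pat_pred //; congr (Some (wpat _ _)); rewrite /woff ox (negbTE ox1); lia.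
  left; rewrite /turns ox wallX (_ : b + j%:Z = b + w%:Z - 1) ?wr //; lia.
have ox1 : odd (x - 1)%R by rewrite odd_pred8 ox.
case: j hj Hs Hp => [|j] hj Hs Hp.
  rewrite addr0 in Hs Hp *; apply: step_codeof_live (Hs) _.
    rewrite /source /turns ox wallX wl -[LHS]/(codeof _ _) Hp.
    rewrite pat_pred //; congr (Some (wpat _ _)); rewrite /woff ox ox1; lia.
  by left; rewrite /turns ox wallX wl.
have Hn := H x j (ltnW hj).
rewrite (_ : woff x j.+1 t.+1 = woff x j t); last by rewrite /woff ox; lia.
have Ej : b + j.+1%:Z - 1 = b + j%:Z by lia.
apply: step_codeof_live (Hs) _.
  by rewrite /source /turns ox Ej wallX wi ?Hn //; lia.
right; apply/negP => /andP[f /eqP]; rewrite Hp => /Some_inj; apply: no_meeting => //.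
  by rewrite subrK.
by rewrite /woff ox ox1; lia.
Qed.

Lemma good_coded t b : good (X 0) b -> coded (X t) b t.
Proof. by move=> [hw hc]; elim: t => // t; apply: coded_succ. Qed.

Lemma coded_period c b : coded c b (8 * w) <-> coded c b 0.
Proof.
have E x j : wpat x (woff x j (8 * w)%N) = wpat x (woff x j 0%N).
  rewrite -[LHS]pat_period //; congr wpat; rewrite /woff; case: ifP; lia.
by split=> H x j hj; rewrite H // E.
Qed.

Lemma good_macrostep b : good (X (8 * w)) b <-> good (X 0) b.
Proof.
split=> -[hw hc].
  have hw1 := (walledX _ b).1 hw.
  split=> //; move/coded_period: hc; elim: (8 * w)%N => // t IH /(coded_pred hw1).
  exact: IH.
split; first exact: (walledX _ b).2.
by apply/coded_period; apply: good_coded.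
Qed.

(** * Comparison of codes across a wall *)

Lemma matchesP s o : reflect (forall x : 'I_8, codeof o x =
    if odd x then retag 1 (codeof s (x - 1)) else retag (-1) (codeof s (x + 1))) (matches s o).
Proof. by apply: (iffP forallP) => H x; apply/eqP. Qed.

(** Tracks of opposite directions have equal offsets at the two facing ends, so the letters agree
    and only the tags are shifted. *)
Lemma matches_right t b : good (X 0) b ->
  reflect (forall x : 'I_8, codeof (X t (b + w%:Z)) x = Some (wpat x (woff x 0 t)))
    (matches (X t (b + w%:Z - 1)) (X t (b + w%:Z))).
Proof.
move=> gb; have E (y : 'I_8) : codeof (X t (b + w%:Z - 1)) y = Some (wpat y (woff y w.-1 t)).
  by rewrite -(good_coded t gb); [congr (codeof (X _ _)); lia | lia].
apply: (iffP (matchesP _ _)) => H x; rewrite H;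
 rewrite !E !retag_pat subrK addrK /woff odd_succ8 odd_pred8; case ox: (odd x) => /=;
 congr (Some (wpat _ _)); lia.
Qed.

Lemma matches_left t b : good (X 0) b ->
  reflect (forall x : 'I_8, codeof (X t (b - 1)) x = Some (wpat x (woff x w.-1 t)))
    (matches (X t b) (X t (b - 1))).
Proof.
move=> gb; have E (y : 'I_8) : codeof (X t b) y = Some (wpat y (woff y 0 t)).
  by rewrite -(good_coded t gb) ?addr0 //; lia.
apply: (iffP (matchesP _ _)) => H x; rewrite H;
 rewrite !E !retag_pat subrK addrK /woff odd_succ8 odd_pred8; case ox: (odd x) => /=;
 congr (Some (wpat _ _)); lia.
Qed.

Lemma forth_left t z (x : 'I_8) c d : odd x -> wall (X 0 z) = false ->
  codeof (X t (z + 1)) x = Some c -> codeof (X t z) (x - 1) = Some d -> d != c ->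
  codeof (X t.+1 z) x = Some c.
Proof.
move=> ox wz E1 E2 dc; rewrite stepX; apply: step_codeof_live (E2) _.
  by rewrite /source /turns ox wallX wz.
by right; rewrite E2 (inj_eq Some_inj) (negbTE dc) andbF.
Qed.

Lemma forth_right t z (x : 'I_8) c d : ~~ odd x -> wall (X 0 (z - 1)) = false ->
  codeof (X t (z - 1)) x = Some c -> codeof (X t z) (x - 1) = Some d -> d != c ->
  codeof (X t.+1 z) x = Some c.
Proof.
move=> /negbTE ox wz E1 E2 dc; rewrite stepX; apply: step_codeof_live (E2) _.
  by rewrite /source /turns ox wallX wz.
by right; rewrite E2 (inj_eq Some_inj) (negbTE dc) andbF.
Qed.

Lemma good_right b : wall (X 0 (b - 1)) ->
  (forall (t : nat) (x : 'I_8), (t < 2 * w)%N -> codeof (X t b) x = Some (wpat x (woff x 0 t))) ->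
  good (X 0) b.
Proof.
move=> wl obs.
pose tr (x : 'I_8) (d t : nat) := codeof (X t (b + d%:Z)) x.
pose fw (d : nat) := wall (X 0 (b + d%:Z)).
have bi (x : 'I_8) d t k : odd x -> tr x d t.+1 = Some k ->
  if fw d then tr (x - 1) d t = Some k
  else tr x d.+1 t = Some k /\ ~~ (is_first k.1 && (tr (x - 1) d t == Some k)).
  move=> ox /(back_left ox); rewrite wallX /fw /tr.
  by rewrite (_ : b + d.+1%:Z = b + d%:Z + 1) //; lia.
have bo (x : 'I_8) d t k : ~~ odd x -> fw d = false -> tr x d.+1 t.+1 = Some k -> tr x d t = Some k.
  move=> ox wd /(back_right ox); rewrite wallX.
  by rewrite (_ : b + d.+1%:Z - 1 = b + d%:Z) ?[wall _]wd; [case | lia].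
have fo d t k k' : fw d = false -> tr 0 d t = Some k -> tr 7 d.+1 t = Some k' ->
  k' != k -> tr 0 d.+1 t.+1 = Some k.
  move=> wd E1 E2; have Ed : b + d.+1%:Z - 1 = b + d%:Z by lia.
  by apply: forth_right; rewrite ?Ed // -E2; congr codeof; apply/val_inj.
have bd (x : 'I_8) (t : nat) : (t < 2 * w)%N -> tr x 0%N t = Some (wpat (x + 0) (woff x 0 t)).
  by move=> ht; rewrite /tr !addr0 obs.
have W := no_wall_before w_gt1 bi bo bd.
have Wr := wall_at_width w_gt1 firstQ bi bo fo bd.
have C := window_codes w_gt1 firstQ bi bo fo bd.
split; last by move=> x j hj; rewrite -[LHS]/(tr _ _ _) C // addr0.
by split=> //; rewrite -[is_true _]/(is_true (wall _)) (_ : b + w%:Z - 1 = b + w.-1%:Z) //; lia.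
Qed.

Lemma good_left b : wall (X 0 (b + w%:Z - 1)) ->
  (forall (t : nat) (x : 'I_8), (t < 2 * w)%N ->
     codeof (X t (b + w%:Z - 1)) x = Some (wpat x (woff x w.-1 t))) ->
  good (X 0) b.
Proof.
move=> wr obs.
pose tr (x : 'I_8) (d t : nat) := codeof (X t (b + w%:Z - 1 - d%:Z)) (x + 1).
pose fw (d : nat) := wall (X 0 (b + w%:Z - 1 - d%:Z - 1)).
have Ed d : b + w%:Z - 1 - d.+1%:Z = b + w%:Z - 1 - d%:Z - 1 by lia.
have Ed' d : b + w%:Z - 1 - d%:Z = b + w%:Z - 1 - d.+1%:Z + 1 by lia.
have bi (x : 'I_8) d t k : odd x -> tr x d t.+1 = Some k ->
  if fw d then tr (x - 1) d t = Some k
  else tr x d.+1 t = Some k /\ ~~ (is_first k.1 && (tr (x - 1) d t == Some k)).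
  move=> ox; have ox1 : ~~ odd (x + 1)%R by rewrite odd_succ8 ox.
  by move=> /(back_right ox1); rewrite wallX /fw /tr Ed addrK subrK.
have bo (x : 'I_8) d t k : ~~ odd x -> fw d = false -> tr x d.+1 t.+1 = Some k -> tr x d t = Some k.
  move=> ox; have ox1 : odd (x + 1)%R by rewrite odd_succ8 ox.
  move=> wd /(back_left ox1); rewrite wallX Ed -/(fw d) wd => -[].
  by rewrite -Ed -Ed'.
have fo d t k k' : fw d = false -> tr 0 d t = Some k -> tr 7 d.+1 t = Some k' ->
  k' != k -> tr 0 d.+1 t.+1 = Some k.
  move=> wd E1 E2; apply: forth_left; rewrite ?Ed //; first by rewrite -Ed -Ed'.
  by rewrite -Ed -E2; congr codeof; apply/val_inj.
have bd (x : 'I_8) (t : nat) : (t < 2 * w)%N -> tr x 0%N t = Some (wpat (x + 1) (woff x 0 t)).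
  move=> ht; rewrite /tr subr0 obs //; congr (Some (wpat _ _)).
  by rewrite /woff odd_succ8; case: (odd x) => /=; lia.
have W := no_wall_before w_gt1 bi bo bd.
have Wr := wall_at_width w_gt1 firstQ bi bo fo bd.
have C := window_codes w_gt1 firstQ bi bo fo bd.
split.
  split=> //; first by move: Wr; rewrite /fw; congr (is_true (wall (X _ _))); lia.
  move=> j hj; have := W (w.-2 - j)%N ltac:(lia).
  by rewrite /fw => <-; congr (wall (X _ _)); lia.
move=> x j hj; have := C (x - 1) (w.-1 - j)%N ltac:(lia).
rewrite /tr !subrK (_ : b + w%:Z - 1 - _ = b + j%:Z); last by lia.
move=> ->; congr (Some (wpat _ _)).
by rewrite /woff odd_pred8; case: (odd x) => /=; lia.
Qed.

End Evolution.

(** * Links and payloads *)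

Lemma payload_step l s r (x y : 'I_8) c : codeof s y = Some c ->
  payload (step l s r) x = new_payload l s r x.
Proof.
move=> Ey; rewrite /step; case: eqP => [es|_]; last by rewrite /payload /track ffunE.
by move: Ey; rewrite es /codeof /track ffunE.
Qed.

Lemma mark_step l s r : mark (step l s r) = if s == dead then false else new_mark s.
Proof. by rewrite /step; case: eqP. Qed.

Lemma link_right_step l s r (y : 'I_8) c : codeof s y = Some c ->
  link_right (step l s r) = new_link 0 s r (link_right s).
Proof. by move=> Ey; rewrite /step; case: eqP => // es; move: Ey; rewrite es /codeof /track ffunE. Qed.

Lemma link_left_step l s r (y : 'I_8) c : codeof s y = Some c ->
  link_left (step l s r) = new_link 1 s l (link_left s).
Proof. by move=> Ey; rewrite /step; case: eqP => // es; move: Ey; rewrite es /codeof /track ffunE. Qed.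

Lemma sub_ord8_eq0 (x : 'I_8) (q : nat) : (q < 8)%N -> (x - q%:R == x) = (q == 0%N).
Proof.
rewrite -subr_eq0 addrAC subrr add0r oppr_eq0.
by case: q => [|[|[|[|[|[|[|[|q]]]]]]]].
Qed.

Lemma sub_ord8_eq1 (x : 'I_8) (q : nat) : (q < 8)%N -> (x - q%:R == x - 1) = (q == 1%N).
Proof.
rewrite (inj_eq (addrI _)) (inj_eq oppr_inj).
by case: q => [|[|[|[|[|[|[|[|q]]]]]]]].
Qed.

Section Dynamics.
Variables (w : nat) (Q : nat -> letter).
Hypothesis w_gt1 : (1 < w)%N.
Hypothesis firstQ : forall u, (u < w)%N -> is_first (Q u) = (u == 0%N).
Variable X : nat -> int -> cell.
Hypothesis stepX : forall t z, X t.+1 z = step (X t (z - 1)) (X t z) (X t (z + 1)).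

Local Notation wpat := (pat w Q).
Local Notation woff := (off w).
Local Notation wgood := (good w Q).

(** The end cell reads the time off its own belt: the tag on track [x] is [x - t %/ w], so [x] and
    [x - 1] mean [t < 2w], while a first code of tag [x + 1] on track [x + 1] means [t = 0]. *)
Lemma new_link_at (x : 'I_8) s o b (t : nat) : (t < 8 * w)%N ->
  codeof s x = Some (wpat x (w%:Z - 1 - t%:Z)) ->
  codeof s (x + 1) = Some (wpat (x + 1) (- t%:Z)) ->
  new_link x s o b =
    if t == 0%N then matches s o else if (t < 2 * w)%N then b && matches s o else b.
Proof.
move=> ht E1 E2; rewrite /new_link E1 E2.
have w0 : (0 < w)%N by lia.
have hq : (t %/ w < 8)%N by rewrite ltn_divLR.
have Et := divn_eq t w; have hr := ltn_pmod t w0.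
set q := (t %/ w)%N in hq Et *; set r := (t %% w)%N in Et hr *.
have -> : wpat x (w%:Z - 1 - t%:Z) = (Q (w.-1 - r)%N, x - q%:R).
  by rewrite (@patE w Q w_gt1 x _ (- q%:Z) (w.-1 - r)%N) ?rmorphN //; lia.
rewrite {2 3}/has_tag sub_ord8_eq0 // sub_ord8_eq1 //.
have -> : has_tag (Some (wpat (x + 1) (- t%:Z))) (x + 1) &&
          test_code is_first (Some (wpat (x + 1) (- t%:Z))) = (t == 0%N).
  rewrite /has_tag /test_code.
  have [r0|r0] := eqVneq r 0%N.
    rewrite (@patE w Q w_gt1 _ _ (- q%:Z) 0%N) ?rmorphN //=; last by lia.
    rewrite sub_ord8_eq0 // firstQ // eqxx andbT; have := muln_eq0 q w; lia.
  rewrite (@patE w Q w_gt1 _ _ (- q.+1%:Z) (w - r)%N) //=; try lia.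
  by rewrite firstQ; [rewrite (_ : _ == 0%N = false) ?andbF; lia | lia].
case: (t == 0%N) => //; congr (if _ then _ else _).
by rewrite -ltn_divLR // -/q; lia.
Qed.

(** The link is overwritten at time 0, which makes its initial value harmless, and is frozen from
    time [2w] on. *)
Lemma link_window (x : 'I_8) (s o : nat -> cell) (l : nat -> bool) :
  (forall t : nat, codeof (s t) x = Some (wpat x (w%:Z - 1 - t%:Z))) ->
  (forall t : nat, codeof (s t) (x + 1) = Some (wpat (x + 1) (- t%:Z))) ->
  (forall t, l t.+1 = new_link x (s t) (o t) (l t)) ->
  forall t, (2 * w <= t <= 8 * w)%N ->
  reflect (forall t', (t' < 2 * w)%N -> matches (s t') (o t')) (l t).
Proof.
move=> E1 E2 El t ht.
have A n : (n < 2 * w)%N -> l n.+1 = all (fun i => matches (s i) (o i)) (iota 0 n.+1).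
  elim: n => [|n IH] hn; first by rewrite El (new_link_at _ _ _ (E1 _) (E2 _)) /= ?andbT; lia.
  rewrite El (new_link_at _ _ _ (E1 _) (E2 _)); last by lia.
  by rewrite hn IH; [rewrite -(addn1 n.+1) iotaD all_cat /= andbT add0n | lia].
have B n : (2 * w + n <= 8 * w)%N -> l (2 * w + n)%N = all (fun i => matches (s i) (o i)) (iota 0 (2 * w)).
  elim: n => [|n IH] hn; first by rewrite addn0 -{1}(prednK (n := 2 * w)) ?A ?prednK //; lia.
  rewrite addnS El (new_link_at _ _ _ (E1 _) (E2 _)); last by lia.
  by rewrite ltnNge leq_addr /= IH; [case: eqP => //; lia | lia].
rewrite -(subnKC (n := t) (m := 2 * w)) ?B; try lia.
apply: (iffP allP) => H i; first by move=> hi; apply: H; rewrite mem_iota.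
by rewrite mem_iota => hi; apply: H.
Qed.

Section Block.
Variable b : int.
Hypothesis gb : wgood (X 0) b.

Lemma code_at t (j : nat) (x : 'I_8) : (j < w)%N ->
  codeof (X t (b + j%:Z)) x = Some (wpat x (woff x j t)).
Proof. by move=> hj; apply: (good_coded w_gt1 firstQ stepX t gb). Qed.

Lemma code_at_left t (x : 'I_8) : codeof (X t b) x = Some (wpat x (woff x 0 t)).
Proof. by rewrite -(code_at t x (j := 0)) ?addr0 //; lia. Qed.

Lemma code_at_right t (x : 'I_8) :
  codeof (X t (b + w%:Z - 1)) x = Some (wpat x (woff x w.-1 t)).
Proof. by rewrite -(code_at t x (j := w.-1)); [congr (codeof (X _ _)); lia | lia]. Qed.

Lemma link_rightP t : (2 * w <= t <= 8 * w)%N ->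
  reflect (wgood (X 0) (b + w%:Z)) (link_right (X t (b + w%:Z - 1))).
Proof.
move=> ht.
have R := @link_window 0 (fun t => X t (b + w%:Z - 1)) (fun t => X t (b + w%:Z))
  (fun t => link_right (X t (b + w%:Z - 1))) _ _ _ t ht.
have {R} R := R ltac:(by move=> t'; rewrite code_at_right /off /=; congr (Some (wpat _ _)); lia)
  ltac:(by move=> t'; rewrite code_at_right /off /=; congr (Some (wpat _ _)); lia)
  ltac:(by move=> t'; rewrite stepX (link_right_step _ _ (code_at_right t' 0)) subrK).
apply: (iffP R) => H.
  apply: (good_right w_gt1 firstQ stepX); first by case: gb.1.
  by move=> t' x /H /(matches_right w_gt1 firstQ stepX _ gb).
move=> t' _; apply/(matches_right w_gt1 firstQ stepX _ gb) => x.
by rewrite -(good_coded w_gt1 firstQ stepX t' H) ?addr0 //; lia.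
Qed.

Lemma link_leftP t : (2 * w <= t <= 8 * w)%N ->
  reflect (wgood (X 0) (b - w%:Z)) (link_left (X t b)).
Proof.
move=> ht.
have R := @link_window 1 (fun t => X t b) (fun t => X t (b - 1))
  (fun t => link_left (X t b)) _ _ _ t ht.
have {R} R := R ltac:(by move=> t'; rewrite code_at_left /off /=; congr (Some (wpat _ _)); lia)
  ltac:(by move=> t'; rewrite code_at_left /off /=; congr (Some (wpat _ _)); lia)
  ltac:(by move=> t'; rewrite stepX (link_left_step _ _ (code_at_left t' 0))).
have Eb : b - w%:Z + w%:Z - 1 = b - 1 by rewrite subrK.
apply: (iffP R) => H.
  apply: (good_left w_gt1 firstQ stepX); first by rewrite Eb; case: gb.1.
  by move=> t' x /H /(matches_left w_gt1 firstQ stepX _ gb); rewrite Eb.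
move=> t' _; apply/(matches_left w_gt1 firstQ stepX _ gb) => x.
rewrite -(good_coded w_gt1 firstQ stepX t' H); last by lia.
by congr (codeof (X _ _)); lia.
Qed.

Local Notation pay x j t := (payload (X t (b + (j : nat)%:Z)) x).

Lemma pay_right (x : 'I_8) j t : ~~ odd x -> (j.+1 < w)%N ->
  pay x j.+1 t.+1 = pay x j t || [&& x == 4, mark (X t (b + j%:Z)) &
                                   test_code output (codeof (X t (b + j%:Z)) 5)].
Proof.
move=> /negbTE ox hj; rewrite stepX (payload_step _ _ _ (code_at t 0 hj)).
rewrite (_ : b + j.+1%:Z - 1 = b + j%:Z); last by lia.
rewrite /new_payload /source /turns ox (wallX stepX).
by have [[_ _ wi] _] := gb; rewrite wi //; lia.
Qed.

Lemma pay_left (x : 'I_8) j t : odd x -> (j.+1 < w)%N ->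
  pay x j t.+1 = pay x j.+1 t.
Proof.
move=> ox hj; rewrite stepX (payload_step _ _ _ (code_at t 0 (ltnW hj))).
rewrite (_ : b + j%:Z + 1 = b + j.+1%:Z); last by lia.
rewrite /new_payload /source /turns ox (wallX stepX).
have [[_ _ wi] _] := gb; rewrite wi; last by lia.
by case: eqP => [ex|_]; [move: ox; rewrite ex | rewrite orbF].
Qed.

Lemma pay_turn_right (x : 'I_8) t : odd x ->
  pay x w.-1 t.+1 =
  if (x == 1) && has_tag (codeof (X t (b + w%:Z - 1)) 0) 5
  then link_right (X t (b + w%:Z - 1)) && payload (X t (b + w%:Z)) 1
  else pay (x - 1) w.-1 t.
Proof.
move=> ox; rewrite (_ : b + w.-1%:Z = b + w%:Z - 1); last by lia.
rewrite stepX (payload_step _ _ _ (code_at_right t 0)) subrK.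
rewrite /new_payload /turns ox (wallX stepX).
case: gb => -[_ -> _] _; case: ifP => // _.
rewrite (_ : x == 2 = false) 1?(_ : x == 4 = false) //.
  by apply/eqP => ex; move: ox; rewrite ex.
by apply/eqP => ex; move: ox; rewrite ex.
Qed.

Lemma pay_turn_left (x : 'I_8) t : ~~ odd x ->
  pay x 0 t.+1 =
  if (x == 2) && has_tag (codeof (X t b) 1) 7
  then link_left (X t b) && payload (X t (b - 1)) 0
  else (x != 4) && pay (x - 1) 0 t.
Proof.
move=> ox; rewrite !addr0 stepX (payload_step _ _ _ (code_at_left t 0)).
rewrite /new_payload /turns (negbTE ox) (wallX stepX).
case: gb => -[-> _ _] _; rewrite (_ : x == 1 = false) //.
by apply/eqP => ex; move: ox; rewrite ex.
Qed.

Lemma run_right (x : 'I_8) j n t t' : ~~ odd x -> x != 4 -> (j + n < w)%N -> t' = (t + n)%N ->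
  pay x (j + n)%N t' = pay x j t.
Proof.
move=> ox x4 + ->; elim: n => [|n IH]; first by rewrite !addn0.
by rewrite !addnS => h; rewrite pay_right // (negbTE x4) orbF IH //; lia.
Qed.

Lemma run_left (x : 'I_8) j n t t' : odd x -> (j + n < w)%N -> t' = (t + n)%N ->
  pay x j t' = pay x (j + n)%N t.
Proof.
move=> ox + ->; elim: n j => [|n IH] j; first by rewrite !addn0.
by rewrite addnS => h; rewrite addnS pay_left ?IH ?addSn //; lia.
Qed.

End Block.
End Dynamics.

(** * One macrostep *)

Section Macrostep.
Variables (w : nat) (Q : nat -> letter).
Hypothesis w_gt1 : (1 < w)%N.
Hypothesis firstQ : forall u, (u < w)%N -> is_first (Q u) = (u == 0%N).
Hypothesis initQ : forall u, (u < w)%N -> is_init (Q u) = (u == w.-1).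
Hypothesis bitQ : is_bit (Q w.-1) = false.
Variable X : nat -> int -> cell.
Hypothesis stepX : forall t z, X t.+1 z = step (X t (z - 1)) (X t z) (X t (z + 1)).

Local Notation wpat := (pat w Q).
Local Notation woff := (off w).
Local Notation wgood := (good w Q).

Definition stored (c : int -> cell) (b : int) (q : nat) : bool := payload (c (b + q%:Z)) 6.

Lemma tag_pat (x g : 'I_8) (a z : int) (u : nat) :
  a = z * w%:Z + u%:Z -> (u < w)%N -> has_tag (Some (wpat x a)) g = (x + z%:~R == g).
Proof. by move=> e h; rewrite (patE Q w_gt1 x e h). Qed.

Lemma add0z (b : int) : b + 0%N%:Z = b. Proof. exact: addr0. Qed.

Lemma addw1 (b : int) : b + w.-1%:Z = b + w%:Z - 1. Proof. by lia. Qed.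

Section Stored.
Variable b : int.
Hypothesis gb : wgood (X 0) b.

Local Notation pay x j t := (payload (X t (b + (j : nat)%:Z)) x).

Let run_r := @run_right w Q w_gt1 firstQ X stepX b gb.
Let run_l := @run_left w Q w_gt1 firstQ X stepX b gb.
Let turn_r := @pay_turn_right w Q w_gt1 firstQ X stepX b gb.
Let turn_l := @pay_turn_left w Q w_gt1 firstQ X stepX b gb.

Lemma full_right (x : 'I_8) j t t' : ~~ odd x -> x != 4 -> (j < w)%N -> t' = (t + (w.-1 - j))%N ->
  pay x w.-1 t' = pay x j t.
Proof.
move=> ox x4 hj et; rewrite -(@run_r x j (w.-1 - j)%N t t' ox x4 ltac:(lia) et).
by congr (payload (X _ (_ + _)) _); lia.
Qed.

Lemma full_left (x : 'I_8) t t' : odd x -> t' = (t + w.-1)%N -> pay x 0%N t' = pay x w.-1 t.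
Proof. by move=> ox et; rewrite (@run_l x 0%N w.-1 t t' ox ltac:(lia) et). Qed.

(** The item turns onto track 7 at time [w - q] and onto track 0 at time [2w - q]. *)
Lemma stored_right q t : (q < w)%N -> t = (3 * w - 1 - q)%N ->
  payload (X t (b + w%:Z - 1)) 0 = stored (X 0) b q.
Proof.
move=> hq ->; rewrite -addw1 (@full_right 0 0 (2 * w - q).-1.+1) //; try lia.
rewrite turn_l //= (_ : 0 - 1 = 7 :> 'I_8); last exact/val_inj.
rewrite (@full_left 7 (w - q).-1.+1) //; try lia.
rewrite turn_r //= (_ : 7 - 1 = 6 :> 'I_8); last exact/val_inj.
by rewrite (@full_right 6 q 0) //; lia.
Qed.

Lemma stored_left q t : (q < w)%N -> t = (4 * w - 1 - q)%N ->
  payload (X t b) 1 = stored (X 0) b q.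
Proof.
move=> hq ->; rewrite -{1}(add0z b) (@full_left 1 (3 * w - 1 - q).+1) //; try lia.
rewrite turn_r // (code_at_right w_gt1 firstQ stepX gb).
rewrite (@tag_pat 0 5 _ (-2) q) //; last by rewrite /off /=; lia.
(* The item has tag 6, so the turn onto track 1 does not replace its payload by a fetched bit. *)
rewrite (_ : (0 + (-2)%:~R == 5 :> 'I_8) = false) // ?andbF ?andbT.
by rewrite /= subrr addw1 (@stored_right q).
Qed.

Lemma stored_test q j t : (q < w)%N -> (j < w)%N -> t = (4 * w + j - q)%N ->
  pay 2 j t = stored (X 0) b q.
Proof.
move=> hq hj ->; rewrite -{1}[j]add0n (@run_r 2 0 j (4 * w - 1 - q).+1) //; try lia.
rewrite turn_l // (code_at_left w_gt1 firstQ stepX gb).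
rewrite (@tag_pat 1 7 _ (-3) q) //; last by rewrite /off /=; lia.
rewrite (_ : (1 + (-3)%:~R == 7 :> 'I_8) = false) // ?andbF ?andbT.
rewrite /= (_ : 2 - 1 = 1 :> 'I_8); last exact/val_inj.
by rewrite add0z (@stored_left q).
Qed.

Lemma stored_out q : (q < w)%N ->
  stored (X (8 * w)) b q = pay 4 w.-1 (7 * w - 1 - q)%N.
Proof.
move=> hq; rewrite /stored -{1}[q]add0n (@run_r 6 0 q (8 * w - 1 - q).+1) //; try lia.
rewrite turn_l //= (_ : 6 - 1 = 5 :> 'I_8); last exact/val_inj.
rewrite (@full_left 5 (7 * w - 1 - q).+1) //; try lia.
by rewrite turn_r //= (_ : 5 - 1 = 4 :> 'I_8) //; apply/val_inj.
Qed.

End Stored.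

Section Block.
Variable b : int.
Hypothesis gb : wgood (X 0) b.
Variables gl gr : bool.
Hypothesis glP : reflect (wgood (X 0) (b - w%:Z)) gl.
Hypothesis grP : reflect (wgood (X 0) (b + w%:Z)) gr.

Local Notation pay x j t := (payload (X t (b + (j : nat)%:Z)) x).

Let run_r := @run_right w Q w_gt1 firstQ X stepX b gb.

(** The own item of tag 7 turns onto track 2 from time [3w - 1 - q], when bit [q] of the left
    neighbour is just across the wall on track 0. This time is at least [2w], so the link is already
    decided. *)
Lemma left_test q j t : (q < w)%N -> (j < w)%N -> t = (3 * w + j - q)%N ->
  pay 2 j t = gl && stored (X 0) (b - w%:Z) q.
Proof.
move=> hq hj ->; rewrite -{1}[j]add0n (@run_r 2 0 j (3 * w - 1 - q).+1) //; try lia.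
rewrite (pay_turn_left w_gt1 firstQ stepX gb) // (code_at_left w_gt1 firstQ stepX gb).
rewrite (@tag_pat 1 7 _ (-2) q) //; last by rewrite /off /=; lia.
rewrite (_ : (1 + (-2)%:~R == 7 :> 'I_8) = true) // ?andbF ?andbT.
rewrite /= (sameP (link_leftP w_gt1 firstQ stepX gb _) glP); last by lia.
case: glP => // g; rewrite /= -(@stored_right _ g q (3 * w - 1 - q)) //.
by congr (payload (X _ _) _); lia.
Qed.

(** The bit is fetched by the item of tag 5 at the right end, from time [4w - 1 - q], and then
    crosses the block on track 1. *)
Lemma right_test q j t : (q < w)%N -> (j < w)%N -> t = (5 * w + j - q)%N ->
  pay 2 j t = gr && stored (X 0) (b + w%:Z) q.
Proof.
move=> hq hj ->; rewrite -{1}[j]add0n (@run_r 2 0 j (5 * w - 1 - q).+1) //; try lia.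
rewrite (pay_turn_left w_gt1 firstQ stepX gb) // (code_at_left w_gt1 firstQ stepX gb).
rewrite (@tag_pat 1 7 _ (-4) q) //; last by rewrite /off /=; lia.
rewrite (_ : (1 + (-4)%:~R == 7 :> 'I_8) = false) // ?andbF ?andbT.
rewrite /= (_ : 2 - 1 = 1 :> 'I_8); last exact/val_inj.
rewrite (@full_left _ gb 1 (4 * w - 1 - q).+1) //; try lia.
rewrite (pay_turn_right w_gt1 firstQ stepX gb) // (code_at_right w_gt1 firstQ stepX gb).
rewrite (@tag_pat 0 5 _ (-3) q) //; last by rewrite /off /=; lia.
rewrite (_ : (0 + (-3)%:~R == 5 :> 'I_8) = true) // ?andbF ?andbT.
rewrite /= (sameP (link_rightP w_gt1 firstQ stepX gb _) grP); last by lia.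
by case: grP => // g; rewrite /= (@stored_left _ g q).
Qed.

(** The letter that the right-moving item of letter [Q q] meets in cell [j]. *)
Definition table (j q : nat) : letter := Q (absz ((q%:Z - 2 * j%:Z - 1) %% w%:Z)%Z).

Lemma table_pat (x : 'I_8) (a z : int) (j q : nat) :
  a = q%:Z - 2 * j%:Z - 1 + z * w%:Z -> (wpat x a).1 = table j q.
Proof. by move=> ->; rewrite /pat /= addrC modzMDl. Qed.

(** At this time cell [j] holds on track 2 the item of tag [7 - a] and letter [Q q]. *)
Definition passes (j a q : nat) : bool :=
  is_bit (Q q) ==> (pay 2 j (3 * w + a * w + j - q)%N == expected (7 - a%:R) (table j q)).

(** At cell [j] the items of track 2 arrive by increasing [a], i.e. by decreasing tag,
    and for each tag by decreasing [q]. *)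
Lemma mark_succ j a q : (j < w)%N -> (q < w)%N -> (a < 5)%N ->
  mark (X (3 * w + a * w + j - q).+1 (b + j%:Z)) =
  if (q == w.-1) && (a == 0%N) then selects (table j w.-1)
  else mark (X (3 * w + a * w + j - q) (b + j%:Z)) && ((a < 3)%N ==> passes j a q).
Proof.
move=> hj hq ha; set t := (3 * w + a * w + j - q)%N.
rewrite stepX mark_step; have E2 := code_at w_gt1 firstQ stepX gb t 2 hj.
have E3 := code_at w_gt1 firstQ stepX gb t 3 hj.
case: eqP => [ed|_]; first by move: E2; rewrite ed /codeof /track ffunE.
rewrite /new_mark E2 E3 /passes.
rewrite (@patE w Q w_gt1 2 _ (- (a + 3)%N%:Z) q) //; last by rewrite /off /=; lia.
have -> : 2 + (- (a + 3)%N%:Z)%:~R = 7 - a%:R :> 'I_8.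
  rewrite rmorphN /= -pmulrn natrD opprD addrA addrAC; congr (_ - _); exact/val_inj.
have e5 : (5 <= (7 - a%:R : 'I_8)%R)%N = (a < 3)%N by case: a ha {t E2 E3} => [|[|[|[|[|a]]]]].
have e7 : (7 - a%:R == 7 :> 'I_8) = (a == 0%N) by apply: sub_ord8_eq0; lia.
move: (7 - a%:R) e5 e7 => g e5 e7.
have := @table_pat 3 (woff 3 j t) (- (a + 2)%N%:Z) j q; case: (wpat 3 _) => l' g' /= ->; last first.
  by rewrite /off /=; lia.
rewrite initQ // e7 e5.
case: ifP => [/andP[/eqP -> _] //|_].
case: (is_bit (Q q)) => /=; last by rewrite implybT andbT.
by case: (a < 3)%N; rewrite /= ?andbT.
Qed.

(** The tests of cell [j] in their order of arrival. *)
Let ok j n := passes j (n %/ w)%N (w.-1 - n %% w)%N.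

Lemma mark_tests j n : (j < w)%N -> (n < 3 * w)%N ->
  mark (X (2 * w + 2 + j + n) (b + j%:Z)) = selects (table j w.-1) && all (ok j) (iota 0 n.+1).
Proof.
move=> hj; elim: n => [|n IH] hn.
  have := @mark_succ j 0 w.-1 hj ltac:(lia) isT.
  rewrite (_ : (_ - _).+1 = 2 * w + 2 + j + 0)%N; last by lia.
  (* The initializing letter is not a bit, so test number 0 holds vacuously. *)
  by move=> ->; rewrite eqxx /= /ok div0n mod0n subn0 /passes bitQ /= andbT.
have w0 : (0 < w)%N by lia.
have Et := divn_eq n.+1 w; have hr := ltn_pmod n.+1 w0.
have hq : (n.+1 %/ w < 3)%N by rewrite ltn_divLR.
have := @mark_succ j (n.+1 %/ w) (w.-1 - n.+1 %% w) hj ltac:(lia) ltac:(lia).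
set t := (3 * w + _ + _ - _)%N.
have et : t = (2 * w + 2 + j + n)%N by rewrite /t; lia.
rewrite et -addnS => ->; rewrite IH; last by lia.
have -> : all (ok j) (iota 0 n.+2) = all (ok j) (iota 0 n.+1) && ok j n.+1.
  by rewrite -[n.+2]addn1 iotaD all_cat /= andbT.
rewrite hq implyTb -/(ok j n.+1) -andbA.
case: ifP => // /andP[/eqP h1 /eqP h2]; exfalso; lia.
Qed.

(** In this interval the items of tags 4 and 3 pass on track 2; they are not tests, so the mark is
    constant while the outputs are written. *)
Lemma mark_final j t : (j < w)%N -> (5 * w + j < t <= 7 * w + j)%N ->
  mark (X t (b + j%:Z)) = selects (table j w.-1) && all (ok j) (iota 0 (3 * w)).
Proof.
move=> hj ht; rewrite -(subnKC (n := t) (m := (5 * w + j).+1)); last by lia.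
have : ((5 * w + j).+1 + (t - (5 * w + j).+1) <= 7 * w + j)%N by lia.
elim: (t - _)%N => [|n IH] hn.
  rewrite addn0 -(prednK (n := 3 * w)); last by lia.
  by rewrite -mark_tests //; [congr (mark (X _ _)); lia | lia].
rewrite -IH; last by lia.
have w0 : (0 < w)%N by lia.
have Et := divn_eq n w; have hr := ltn_pmod n w0.
have hq : (n %/ w < 2)%N by rewrite ltn_divLR //; lia.
have := @mark_succ j (3 + n %/ w) (w.-1 - n %% w) hj ltac:(lia) ltac:(lia).
set t' := (3 * w + _ + _ - _)%N.
have et : t' = ((5 * w + j).+1 + n)%N by rewrite /t'; lia.
by rewrite et addnS => ->; rewrite !andbT andbF.
Qed.

Lemma all_ok j : (j < w)%N -> all (ok j) (iota 0 (3 * w)) =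
  all (fun u => is_bit (Q u) ==> ((gl && stored (X 0) (b - w%:Z) u, stored (X 0) b u,
    gr && stored (X 0) (b + w%:Z) u) == inputs (table j u))) (iota 0 w).
Proof.
move=> hj; have w0 : (0 < w)%N by lia.
have P u : (u < w)%N -> [&& passes j 0 u, passes j 1 u & passes j 2 u] =
  (is_bit (Q u) ==> ((gl && stored (X 0) (b - w%:Z) u, stored (X 0) b u,
    gr && stored (X 0) (b + w%:Z) u) == inputs (table j u))).
  move=> hu; rewrite /passes.
  rewrite (_ : expected (7 - 0%:R) _ = (inputs (table j u)).1.1) //.
  rewrite (_ : expected (7 - 1%:R) _ = (inputs (table j u)).1.2) //.
  rewrite (_ : expected (7 - 2%:R) _ = (inputs (table j u)).2) //.
  case: (is_bit (Q u)) => //=.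
  rewrite (@left_test u j (3 * w + 0 * w + j - u)) ?(@stored_test _ gb u j (3 * w + 1 * w + j - u))
    ?(@right_test u j (3 * w + 2 * w + j - u)) //; try lia.
  by case: (inputs _) => -[i1 i2] i3; rewrite !xpair_eqE -andbA.
apply/allP/allP => H u; rewrite mem_iota add0n => /andP[_ hu].
  rewrite -P //; apply/and3P; split.
  - have := H (w.-1 - u)%N; rewrite mem_iota /ok divn_small ?modn_small; try lia.
    by rewrite subKn; [apply; lia | lia].
  - have := H (1 * w + (w.-1 - u))%N; rewrite mem_iota /ok divnMDl // modnMDl divn_small ?modn_small; try lia.
    by rewrite subKn; [apply; lia | lia].
  - have := H (2 * w + (w.-1 - u))%N; rewrite mem_iota /ok divnMDl // modnMDl divn_small ?modn_small; try lia.
    by rewrite subKn; [apply; lia | lia].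
have hr := ltn_pmod u w0; have := H (w.-1 - u %% w)%N; rewrite mem_iota => H'.
have {H'} := H' ltac:(lia); rewrite -P; last by lia.
rewrite /ok; have : (u %/ w < 3)%N by rewrite ltn_divLR.
by case: (u %/ w)%N => [|[|[|]]] // _ /and3P[].
Qed.

Lemma stored_macrostep q : (q < w)%N -> stored (X (8 * w)) b q =
  has (fun j => [&& selects (table j w.-1),
    all (fun u => is_bit (Q u) ==> ((gl && stored (X 0) (b - w%:Z) u, stored (X 0) b u,
      gr && stored (X 0) (b + w%:Z) u) == inputs (table j u))) (iota 0 w)
    & output (table j q)]) (iota 0 w.-1).
Proof.
move=> hq; rewrite stored_out //.
set F := (X in has X _).
(* The turn onto track 4 clears the payload. A cell writes onto the item moving to its right
   neighbour, so at cell [m] the cells below [m] have contributed, and cell [w.-1] never writes. *)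
suff H m : (m < w)%N -> pay 4 m (6 * w - q + m)%N = has F (iota 0 m).
  by rewrite -H; [congr (payload (X _ _) _); lia | lia].
elim: m => [|j IH] hj.
  rewrite addn0 -(prednK (n := 6 * w - q)); last by lia.
  by rewrite (pay_turn_left w_gt1 firstQ stepX gb).
rewrite addnS (pay_right w_gt1 firstQ stepX gb) // IH; last by lia.
rewrite -[j.+1]addn1 iotaD has_cat /= add0n orbF /F; congr (_ || _).
rewrite mark_final; try lia.
rewrite all_ok ?(code_at w_gt1 firstQ stepX gb); try lia.
have := @table_pat 5 (woff 5 j (6 * w - q + j)%N) (-5) j q.
rewrite /test_code; case: (wpat 5 _) => l' g' /= ->; first by rewrite andbA.
by rewrite /off /=; lia.
Qed.

End Block.
End Macrostep.

(** * The program of a word rule *)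

Section Program.
Variables (k : nat).
Local Notation word := {ffun 'I_k -> bool}.
Variable F : word -> word -> word -> word.

Definition nrows : nat := #|{: word * word * word}|.
(** One segment of length [2 * nrows] per bit, plus one for the selection of the rows;
    since the width is odd, the [init] item meets a selecting letter in the first
    [nrows] cells only. *)
Definition width : nat := (2 * nrows * k.+1).+1.
Definition bit_at (v : word) (r : nat) : bool := if insub r is Some i then v i else false.
Definition zero_word : word := [ffun=> false].
Definition entry (j : nat) : word * word * word :=
  nth (zero_word, zero_word, zero_word) (enum {: word * word * word}) j.

(** Cell [j] reads the letter of index [wire r - 2j - 1], which is place [2 * (nrows - 1 - j) + 1]
    of segment [r]; halving the place recovers row [j]. Segment [k] holds the selecting letters, at
    odd indices. *)
Definition program (u : nat) : letter :=
  let r := (u %/ (2 * nrows))%N in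
  let e := entry (nrows - 1 - (u %% (2 * nrows))./2)%N in
  (u == 0%N, u == width.-1, [&& 0 < u, 2 * nrows %| u & u < width.-1]%N,
   odd u && (2 * nrows * k < u)%N, (bit_at e.1.1 r, bit_at e.1.2 r, bit_at e.2 r),
   bit_at (F e.1.1 e.1.2 e.2) r).

(** The first index after segment [r], so that the meetings in the first [nrows] cells run backwards
    through that segment. *)
Definition wire (r : nat) : nat := (2 * nrows * r.+1)%N.

Lemma nrows_gt0 : (0 < nrows)%N.
Proof. by apply/card_gt0P; exists (zero_word, zero_word, zero_word). Qed.

Lemma width_gt1 : (1 < width)%N.
Proof. by rewrite /width ltnS !muln_gt0 nrows_gt0. Qed.

Lemma wire_lt r : (r < k)%N -> (wire r < width.-1)%N.
Proof. by move=> h; rewrite /wire /width /= ltn_pmul2l // muln_gt0 nrows_gt0. Qed.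

Lemma program_first u : is_first (program u) = (u == 0%N). Proof. by []. Qed.
Lemma program_init u : is_init (program u) = (u == width.-1). Proof. by []. Qed.
Lemma program_bit u : is_bit (program u) = [&& 0 < u, 2 * nrows %| u & u < width.-1]%N.
Proof. by []. Qed.

Lemma program_bitP u : reflect (exists2 r : nat, (r < k)%N & u = wire r) (is_bit (program u)).
Proof.
rewrite program_bit; apply: (iffP and3P) => [[u0 /dvdnP[r er] uw]|[r hr ->]].
  case: r er => [|r] er; first by rewrite er in u0.
  exists r; last by rewrite er mulnC.
  by move: uw; rewrite er mulnC /width /= ltn_mul2l => /andP[].
split; [by rewrite /wire !muln_gt0 nrows_gt0 | exact: dvdn_mulr | exact: wire_lt].
Qed.

Lemma program_selects j : (j < width)%N ->
  selects (table width program j width.-1) = (j < nrows)%N.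
Proof.
move=> hj; have n0 := nrows_gt0.
have [hn|hn] := ltnP j nrows.
  have e : (width.-1%:Z - 2 * j%:Z - 1 = (width.-1 - 2 * j - 1)%N%:Z) by rewrite /width /=; nia.
  rewrite /table e modz_small; last by rewrite /width /=; nia.
  rewrite /selects /= /width /=; apply/andP; split; last by nia.
  rewrite -subnDA oddB; last by nia.
  by rewrite -mulnA oddD !mul2n !odd_double.
apply/negbTE; have w1 := width_gt1; have [h|h] := leqP (2 * j + 1) width.-1.
  have e : (width.-1%:Z - 2 * j%:Z - 1 = (width.-1 - 2 * j - 1)%N%:Z) by lia.
  rewrite /table e modz_small; last by lia.
  by rewrite /selects /= negb_and; apply/orP; right; rewrite -leqNgt /width /=; lia.
(* Wrapping around adds the odd width, so the index becomes even and its letter does not select. *)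
have e : (width.-1%:Z - 2 * j%:Z - 1 = (-1) * width%:Z + (2 * width.-1 - 2 * j)%N%:Z) by lia.
rewrite /table e modzMDl modz_small; last by lia.
by rewrite /selects /= -mulnBr mul2n odd_double.
Qed.

Lemma program_entry j r : (j < nrows)%N -> (r < k)%N ->
  inputs (table width program j (wire r)) =
    (bit_at (entry j).1.1 r, bit_at (entry j).1.2 r, bit_at (entry j).2 r) /\
  output (table width program j (wire r)) =
    bit_at (F (entry j).1.1 (entry j).1.2 (entry j).2) r.
Proof.
move=> hj hr; have n0 := nrows_gt0.
have hw := wire_lt hr; set u := (2 * nrows - 2 * j - 1)%N.
have hu : (u < 2 * nrows)%N by rewrite /u; lia.
have e : ((wire r)%:Z - 2 * j%:Z - 1 = (r * (2 * nrows) + u)%N%:Z).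
  by rewrite /wire /u; lia.
rewrite /table e modz_small; last first.
  by rewrite -e; move: hw; rewrite /wire; lia.
rewrite absz_nat /inputs /output /= divnMDl ?muln_gt0 // divn_small // addn0.
rewrite modnMDl modn_small // (_ : (nrows - 1 - u./2)%N = j) //.
by rewrite /u; lia.
Qed.

Lemma bit_at_ord (v : word) (r : 'I_k) : bit_at v r = v r.
Proof. by rewrite /bit_at valK. Qed.

Definition word_at (c : int -> cell) (b : int) : word := [ffun r : 'I_k => stored c b (wire r)].

Variable X : nat -> int -> cell.
Hypothesis stepX : forall t z, X t.+1 z = step (X t (z - 1)) (X t z) (X t (z + 1)).

(** The rows enumerate all triples of words, so exactly one selected cell passes its tests, and the
    disjunction reduces to the output of that row. *)
Lemma word_macrostep b (gl gr : bool) : good width program (X 0) b ->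
  reflect (good width program (X 0) (b - width%:Z)) gl ->
  reflect (good width program (X 0) (b + width%:Z)) gr ->
  word_at (X (8 * width)) b =
  F (if gl then word_at (X 0) (b - width%:Z) else zero_word) (word_at (X 0) b)
    (if gr then word_at (X 0) (b + width%:Z) else zero_word).
Proof.
move=> gb glP grP; set x := (if gl then _ else _); set y := word_at (X 0) b.
set z := (if gr then _ else _); apply/ffunP => r; rewrite ffunE.
have bitw : is_bit (program width.-1) = false by rewrite program_bit ltnn !andbF.
have n0 := nrows_gt0; have k1 := ltn_ord r.
have nw : (nrows < width.-1)%N by rewrite /width /=; nia.
have hr := wire_lt k1.
rewrite (stored_macrostep width_gt1 (fun u _ => program_first u) (fun u _ => program_init u)
  bitw stepX gb glP grP); last by lia.
have tests j : (j < nrows)%N ->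
  all (fun u => is_bit (program u) ==>
      ((gl && stored (X 0) (b - width%:Z) u, stored (X 0) b u,
        gr && stored (X 0) (b + width%:Z) u) == inputs (table width program j u)))
    (iota 0 width) = (entry j == (x, y, z)).
  move=> hj; have bits (i : 'I_k) : (gl && stored (X 0) (b - width%:Z) (wire i),
      stored (X 0) b (wire i), gr && stored (X 0) (b + width%:Z) (wire i)) =
      (x i, y i, z i).
    by rewrite /x /y /z; case: (gl); case: (gr); rewrite !ffunE.
  apply/allP/eqP => [H|E u _].
    have E (i : 'I_k) : (x i, y i, z i) = ((entry j).1.1 i, (entry j).1.2 i, (entry j).2 i).
      have := H (wire i); rewrite mem_iota add0n leq0n /=.
      have hi := wire_lt (ltn_ord i); rewrite (_ : (wire i < width)%N); last by lia.
      have -> : is_bit (program (wire i)) by apply/program_bitP; exists (val i); first exact: ltn_ord.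
      move=> /(_ isT) /=; rewrite bits (program_entry hj (ltn_ord i)).1 !bit_at_ord.
      by move/eqP.
    case: (entry j) E => -[e1 e2] e3 E.
    by congr (_, _, _); apply/ffunP => i; case: (E i).
  apply/implyP => /program_bitP[i hi ->]; rewrite (program_entry hj hi).1 E.
  by rewrite (bits (Ordinal hi)) -!bit_at_ord.
apply/hasP/idP => [[j]|Fr].
  rewrite mem_iota add0n => /andP[_ hj]; rewrite program_selects; last by lia.
  move=> /and3P[jn]; rewrite tests // (program_entry jn k1).2 => /eqP -> /=.
  by rewrite bit_at_ord.
have hi : (index (x, y, z) (enum {: word * word * word}) < nrows)%N.
  by rewrite /nrows cardE index_mem mem_enum.
have entryi : entry (index (x, y, z) (enum {: word * word * word})) = (x, y, z).
  by rewrite /entry nth_index // mem_enum.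
exists (index (x, y, z) (enum {: word * word * word})).
  by rewrite mem_iota; lia.
rewrite program_selects; last by lia.
by rewrite hi tests // entryi eqxx (program_entry hi k1).2 entryi bit_at_ord.
Qed.

End Program.

(** * The factor map *)

Lemma nbhs_agree (Q : finType) (W : seq int) (c : config Q) :
  nbhs c [set c' : config Q | forall u, u \in W -> c' u = c u].
Proof.
elim: W => [|u W IH]; first by apply: filterS filterT => c' _ u.
have H : nbhs c [set c' : config Q | c' u = c u].
  exact: (@proj_continuous int (fun _ => discrete_topology Q) u c [set c u] (discrete_set1 (c u))).
apply: filterS (filterI H IH) => c' [/= Hu HW] u'.
by rewrite inE => /orP[/eqP -> //|]; apply: HW.
Qed.

(** The product topology is the supremum of those induced by the coordinates, and each coordinate of
    [f] is constant near [c]. *)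
Lemma local_continuous (Q Q' : finType) (f : config Q -> config Q') (W : int -> seq int) :
  (forall z (c c' : config Q), (forall u, u \in W z -> c' u = c u) -> f c' z = f c z) ->
  continuous f.
Proof.
move=> loc c; have FN : Filter (nbhs c) by exact: (@nbhs_filter _ c).
have FF : Filter (f x @[x --> c]) by exact (@fmap_filter _ _ (fun x => f x) (nbhs c) FN).
have cvgS := @cvg_sup (config Q') int (fun i : int => Topological.class
  (initial_topology (fun g : (forall i : int, discrete_topology Q') => g i)))
  (f x @[x --> c]) (f c) FF.
apply: (proj2 cvgS) => z U [B [[V oV EV] Vc]] BU.
apply: (filterS _ (nbhs_agree (W z) c)) => c' /loc E; apply: BU.
by rewrite -EV in Vc *; rewrite /preimage /mkset E.
Qed.

Definition universal : ca :=
  @CA cell 3 [tuple -1; 0; 1] (fun t => step (tnth t 0) (tnth t 1) (tnth t 2)).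

Lemma universalE (c : config (ca_state universal)) z :
  global_map (A := universal) c z = step (c (z - 1)) (c z) (c (z + 1)).
Proof.
by rewrite /global_map /= !tnth_map !(tnth_nth 0) /= addr0.
Qed.

Lemma universal_persistent : persistent universal.
Proof. by exists dead => c i E; rewrite universalE E /step eqxx. Qed.

(** * Packing to radius one, and the simulation of a persistent automaton *)

Section Simulation.
Variables (A : ca) (q0 : ca_state A).
Hypothesis q0_stable : forall (c : config (ca_state A)) i, c i = q0 -> global_map c i = q0.

Definition reach : nat := (\max_(v <- ca_nbhd A) `|v|%N).+1.
Local Notation m := reach.
Local Notation pack := {ffun 'I_m -> ca_state A}.

Lemma nbhd_reach v : v \in ca_nbhd A -> (`|v| < m)%N.
Proof. by move=> h; rewrite /reach ltnS (@leq_bigmax_seq _ _ xpredT (fun v : int => `|v|%N)). Qed.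

Definition quiescent : pack := [ffun=> q0].
Definition pack_at (s : pack) (z : int) : ca_state A :=
  if insub `|z|%N is Some l then s l else q0.
Definition pack_of (y : config (ca_state A)) (i : int) : pack :=
  [ffun l : 'I_m => y (i * m%:Z + (l : nat)%:Z) : ca_state A].

Lemma pack_ofE y i z : 0 <= z -> z < m%:Z -> pack_at (pack_of y i) z = y (i * m%:Z + z).
Proof.
move=> z0 zm; rewrite /pack_at; have h : (`|z| < m)%N by lia.
by rewrite insubT ffunE /=; congr (y (_ + _)); lia.
Qed.

(** Cells [0, m) hold [b]; [pack_at] pads with [q0], which is never read by the cells
    of the central pack. *)
Definition glue (a b c : pack) : config (ca_state A) := fun z =>
  if z < 0 then pack_at a (z + m%:Z)
  else if z < m%:Z then pack_at b z else pack_at c (z - m%:Z).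

Definition pack_rule (a b c : pack) : pack :=
  [ffun l : 'I_m => global_map (glue a b c) (l : nat)%:Z : ca_state A].

Lemma pack_of_global_map y i :
  pack_of (global_map y) i = pack_rule (pack_of y (i - 1)) (pack_of y i) (pack_of y (i + 1)).
Proof.
apply/ffunP => l; rewrite !ffunE /global_map; congr ca_rule.
apply/val_inj/eq_in_map => v /nbhd_reach hv /=; have hl := ltn_ord l.
rewrite /glue; case: ltP => h1; last case: ltP => h2.
- by rewrite pack_ofE; [congr (y _); lia | lia | lia].
- by rewrite pack_ofE; [congr (y _); lia | lia | lia].
- by rewrite pack_ofE; [congr (y _); lia | lia | lia].
Qed.

(** Here persistence of [A] enters: a bad block, decoded as [quiescent], stays bad whatever its
    neighbours are. *)
Lemma pack_rule_quiescent a c : pack_rule a quiescent c = quiescent.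
Proof.
apply/ffunP => l; rewrite !ffunE; apply: q0_stable.
by rewrite /glue /= ltz_nat ltn_ord /pack_at; case: insubP => // u _ _; rewrite ffunE.
Qed.

Lemma pack_of_inj y y' : (forall i, pack_of y i = pack_of y' i) -> y = y'.
Proof.
move=> E; apply/funext => z.
have h1 : 0 <= (z %% m%:Z)%Z by apply: modz_ge0.
have h2 : (z %% m%:Z)%Z < m%:Z by apply: ltz_pmod.
by rewrite (divz_eq z m%:Z) -(pack_ofE y _ h1 h2) E pack_ofE.
Qed.

Local Notation k := #|{: pack}|.
Local Notation word := {ffun 'I_k -> bool}.

(** One-hot, except that [quiescent] becomes the zero word, which is what an unlinked side
    supplies. *)
Definition encode (s : pack) : word := [ffun r => (enum_val r == s) && (s != quiescent)].
Definition decode (v : word) : pack :=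
  if [pick r | v r] is Some r then enum_val r else quiescent.

Lemma encodeK : cancel encode decode.
Proof.
move=> s; rewrite /decode; case: pickP => [r|H].
  by rewrite ffunE => /andP[/eqP].
have := H (enum_rank s); rewrite ffunE enum_rankK eqxx /=.
by move/negbFE/eqP.
Qed.

Lemma decode0 : decode (zero_word k) = quiescent.
Proof. by rewrite /decode; case: pickP => // r; rewrite ffunE. Qed.

Definition word_rule (x y z : word) : word :=
  encode (pack_rule (decode x) (decode y) (decode z)).

Local Notation w := (width k).
Local Notation Q := (program word_rule).
Local Notation wgood := (good w Q).

Definition decode_block (c : int -> cell) (i : int) : pack :=
  if `[< wgood c (i * w%:Z) >] then decode (word_at k c (i * w%:Z)) else quiescent.

Definition factor_map (c : config (ca_state universal)) : config (ca_state A) :=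
  fun z => pack_at (decode_block c (z %/ m%:Z)%Z) (z %% m%:Z)%Z.

Lemma pack_of_factor_map c i : pack_of (factor_map c) i = decode_block c i.
Proof.
apply/ffunP => l; rewrite ffunE /factor_map; have hl := ltn_ord l.
rewrite divzMDl ?modzMDl // divz_small ?modz_small ?addr0; try lia.
by rewrite /pack_at absz_nat insubT; congr (decode_block _ _ _); apply/val_inj.
Qed.

Lemma factor_map_macrostep c :
  factor_map (iter (8 * w) (@global_map universal) c) = global_map (factor_map c).
Proof.
pose X t := iter t (@global_map universal) c.
have stepX t z : X t.+1 z = step (X t (z - 1)) (X t z) (X t (z + 1)).
  by rewrite /X iterS universalE.
apply: pack_of_inj => i; rewrite pack_of_global_map !pack_of_factor_map.
have gm := good_macrostep (width_gt1 k) (fun u _ => program_first word_rule u) stepX (i * w%:Z).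
rewrite {1}/decode_block -/(X (8 * w)%N).
case: asboolP => [h|h]; last first.
  (* A block that is bad after the macrostep was bad before it. *)
  rewrite [decode_block c i]/decode_block asboolF ?pack_rule_quiescent // => g.
  exact/h/gm.
have g := gm.1 h.
rewrite (@word_macrostep k word_rule X stepX _ `[< wgood (X 0%N) ((i - 1) * w%:Z) >]
  `[< wgood (X 0%N) ((i + 1) * w%:Z) >] g).
- rewrite encodeK /decode_block -/(X 0%N) (asboolT g).
  rewrite mulrBl mulrDl mul1r.
  by congr pack_rule; case: ifP => // _; rewrite decode0.
- by rewrite mulrBl mul1r; apply: asboolP.
- by rewrite mulrDl mul1r; apply: asboolP.
Qed.

Let w_gt1 : (1 < w)%N := width_gt1 k.

(** The window starts at -1 because the left wall of a block is stored in the cell before it. *)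
Lemma good_local c c' b b' :
  (forall j : int, -1 <= j < w%:Z -> c' (b' + j) = c (b + j)) -> wgood c b -> wgood c' b'.
Proof.
move=> E [[h1 h2 h3] h4]; split; first split.
- by rewrite E //; lia.
- by rewrite -addrA E ?addrA //; lia.
- by move=> j hj; rewrite E ?h3 //; lia.
by move=> x j hj; rewrite E ?h4 //; lia.
Qed.

Lemma decode_block_local c c' i i' :
  (forall j : int, -1 <= j < w%:Z -> c' (i' * w%:Z + j) = c (i * w%:Z + j)) ->
  decode_block c' i' = decode_block c i.
Proof.
move=> E; rewrite /decode_block.
have -> : `[< wgood c' (i' * w%:Z) >] = `[< wgood c (i * w%:Z) >].
  apply/asbool_equiv_eq; split; apply: good_local => j hj; first by rewrite E.
  by rewrite -E.
congr (if _ then decode _ else _); apply/ffunP => r; rewrite !ffunE /stored E //.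
by have := wire_lt (ltn_ord r); lia.
Qed.

Lemma factor_map_shift (b : int) c :
  factor_map (Defs.shift (w%:Z * b) c) = Defs.shift (m%:Z * b) (factor_map c).
Proof.
apply/funext => z; rewrite /Defs.shift /factor_map (mulrC m%:Z) (addrC z) modzMDl divzMDl //.
congr (pack_at _ _); apply: decode_block_local => j _.
by congr (c _); rewrite mulrDl; lia.
Qed.

Lemma factor_map_continuous : continuous factor_map.
Proof.
apply: (local_continuous (W := fun z =>
  [seq (z %/ m%:Z)%Z * w%:Z + (u%:Z - 1) | u <- iota 0 w.+1])) => z c c' E.
rewrite /factor_map; congr pack_at; apply: decode_block_local => j hj; apply: E.
by apply/mapP; exists (absz (j + 1)); [rewrite mem_iota; lia | congr (_ + _); lia].
Qed.

(** Position [wire r] has quotient [r.+1] by [2 * nrows k], so it carries bit [r]; [factor_map]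
    reads payloads only at such positions, on track 6. *)
Definition realize (y : config (ca_state A)) : config (ca_state universal) := fun z =>
  let i := (z %/ w%:Z)%Z in let j := `|(z %% w%:Z)%Z|%N in
  ((j == w.-1, [ffun x : 'I_8 => (Some (pat w Q x (off w x j 0)),
     bit_at (encode (pack_of y i)) (j %/ (2 * nrows k)).-1)], (false, (false, false))) : cell).

Lemma realizeE y i (j : nat) : (j < w)%N -> realize y (i * w%:Z + j%:Z) =
  (j == w.-1, [ffun x : 'I_8 => (Some (pat w Q x (off w x j 0)),
     bit_at (encode (pack_of y i)) (j %/ (2 * nrows k)).-1)], (false, (false, false))) :> cell.
Proof.
move=> hj; rewrite /realize divzMDl ?modzMDl; last by lia.
by rewrite divz_small ?modz_small ?addr0 ?absz_nat //; lia.
Qed.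

Lemma realize_wall y i (j : nat) : (j < w)%N ->
  wall (realize y (i * w%:Z + j%:Z)) = (j == w.-1).
Proof. by move=> hj; rewrite realizeE. Qed.

Lemma good_realize y i : wgood (realize y) (i * w%:Z).
Proof.
split; last by move=> x j hj; rewrite realizeE // /codeof /track ffunE.
split.
- rewrite (_ : i * w%:Z - 1 = (i - 1) * w%:Z + w.-1%:Z); last by rewrite mulrBl; lia.
  by rewrite realize_wall ?eqxx //; lia.
- rewrite (_ : i * w%:Z + w%:Z - 1 = i * w%:Z + w.-1%:Z); last by lia.
  by rewrite realize_wall ?eqxx //; lia.
- by move=> j hj; rewrite realize_wall; lia.
Qed.

Lemma factor_map_onto y : factor_map (realize y) = y.
Proof.
apply: pack_of_inj => i; rewrite pack_of_factor_map /decode_block asboolT; last exact: good_realize.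
rewrite -[RHS]encodeK; congr decode; apply/ffunP => r; rewrite ffunE.
have hr := wire_lt (ltn_ord r); rewrite /stored realizeE; last by lia.
by rewrite /payload /track ffunE /= /wire mulKn ?bit_at_ord // muln_gt0 nrows_gt0.
Qed.

Lemma universal_simulates : A ≼ universal.
Proof.
exists (8 * w)%N, w%:Z, 1%N, m%:Z; split=> //.
exists factor_map; split; first exact: factor_map_continuous.
  by move=> y; exists (realize y); apply: factor_map_onto.
move=> _ x [a [b ->]]; rewrite scale_isoE //.
rewrite /canonical_action /= mul1n factor_map_shift; congr Defs.shift.
elim: a => [|a IH]; first by rewrite muln0.
by rewrite mulnS iterD factor_map_macrostep IH.
Qed.

End Simulation.

Theorem theorem2 :
  exists U : ca, persistent U /\ forall A : ca, persistent A -> A ≼ U.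
Proof.
exists universal; split; first exact: universal_persistent.
by move=> A [q0 q0_stable]; apply: universal_simulates q0_stable.
Qed.
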